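(* Let $K\subseteq\mathbb{R}^{n}$ be compact and let $T\subseteq\mathbb{R}^{n}$ be compact with non-empty interior. Then \[ M_{\omega}(K,T)=M^{*}(K,T)=N^{*}(K,-T). \]
   Context: $\mathbbm{1}_A$ denotes the indicator function of $A$. $\mathcal{D}_{+}^{n}$ is the set of non-negative finite discrete measures on $\mathbb{R}^n$ (finite sums $\sum_i\omega_i\delta_{x_i}$ with $\omega_i\ge 0$), and $\mathcal{B}_{+}^{n}$ the set of non-negative regular Borel measures on $\mathbb{R}^n$. For a measure $\nu$, $(\nu*\mathbbm{1}_T)(x)=\int_{\mathbb{R}^n}\mathbbm{1}_T(x-y)\,d\nu(y)$. Define $N^{*}(K,T)=\inf\{\mu(\mathbb{R}^n): \mu\in\mathcal{B}_+^n,\ \mu*\mathbbm{1}_T\ge\mathbbm{1}_K \text{ on } \mathbb{R}^n\}$, $M_{\omega}(K,T)=\sup\{\nu(K): \nu\in\mathcal{D}_+^n,\ \nu*\mathbbm{1}_T\le 1 \text{ on } \mathbb{R}^n\}$, $M^{*}(K,T)=\sup\{\mu(K): \mu\in\mathcal{B}_+^n,\ \mu*\mathbbm{1}_T\le 1 \text{ on } \mathbb{R}^n\}$. *)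

(* Defs.v *)
From HB Require Import structures.
From mathcomp Require Import all_boot all_order all_algebra.
From mathcomp Require Import all_classical all_reals all_analysis.
Set Implicit Arguments. Unset Strict Implicit. Unset Printing Implicit Defensive.
Import Order.TTheory GRing.Theory Num.Theory.
Import numFieldNormedType.Exports.
Local Open Scope classical_set_scope.
Local Open Scope ring_scope.

Definition Rn (R : realType) (n : nat) :=
  g_sigma_algebraType (@open 'rV[R]_n).

Definition regular_measure (R : realType) (n : nat)
  (mu : {measure set (Rn R n) -> \bar R}) : Prop :=
  forall A : set (Rn R n), measurable A ->
    mu A = ereal_inf [set mu U | U in [set U : set 'rV[R]_n | open U /\ A `<=` U]]
    /\ mu A = ereal_sup [set mu C | C in [set C : set 'rV[R]_n | compact C /\ C `<=` A]].

Definition conv_indic (R : realType) (n : nat)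
  (mu : {measure set (Rn R n) -> \bar R}) (T : set 'rV[R]_n) (x : 'rV[R]_n)
  : \bar R :=
  (\int[mu]_(y in [set: Rn R n]) (\1_T (x - y) : R)%:E)%E.

(* Non-negative finite discrete measures nu = sum_i w_i delta_{x_i},
   represented by the finite list of pairs (w_i, x_i) with w_i >= 0. *)
Definition discrete_nonneg (R : realType) (n : nat) (s : seq (R * 'rV[R]_n))
  : Prop := forall p, p \in s -> 0 <= p.1.

Definition dmass (R : realType) (n : nat) (s : seq (R * 'rV[R]_n))
  (A : set 'rV[R]_n) : R :=
  \sum_(p <- s) p.1 * \1_A p.2.

Definition dconv_indic (R : realType) (n : nat) (s : seq (R * 'rV[R]_n))
  (T : set 'rV[R]_n) (x : 'rV[R]_n) : R :=
  \sum_(p <- s) p.1 * \1_T (x - p.2).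

Definition Nstar (R : realType) (n : nat) (K T : set 'rV[R]_n) : \bar R :=
  ereal_inf [set mu [set: Rn R n] | mu in
    [set mu : {measure set (Rn R n) -> \bar R} | regular_measure mu /\
       forall x : 'rV[R]_n, ((\1_K x : R)%:E <= conv_indic mu T x)%E]].

Definition Momega (R : realType) (n : nat) (K T : set 'rV[R]_n) : \bar R :=
  ereal_sup [set (dmass s K)%:E | s in
    [set s : seq (R * 'rV[R]_n) | discrete_nonneg s /\
       forall x : 'rV[R]_n, dconv_indic s T x <= 1]].

Definition Mstar (R : realType) (n : nat) (K T : set 'rV[R]_n) : \bar R :=
  ereal_sup [set mu K | mu in
    [set mu : {measure set (Rn R n) -> \bar R} | regular_measure mu /\
       forall x : 'rV[R]_n, (conv_indic mu T x <= 1)%E]].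

(* Main.v *)
(* Discrete measures are regular, so [Momega <= Mstar]. Weak duality
   [Mstar <= Nstar] is a double count: if [mu (y - T) <= 1] for all [y] and
   [nu (x + T) >= 1] for all [x] in [K], then by Tonelli
   [mu K <= \int_K nu (x + T) dmu(x) <= \int mu (y - T) dnu(y) <= nu setT].
   For strong duality, put [M = Momega K T < +oo]. The Hahn-Banach theorem gives
   a finitely additive [m] on all subsets with [m setT <= M] and
   [m (x + T) >= 1] for [x] in [K]. Its inner content
   [U |-> sup {m C : C compact, C `<=` U}] on open sets extends, by
   Caratheodory, to a regular Borel measure [mu]. Since [mu C >= m C] for
   compact [C] and [T] is compact, [mu] still covers [K], and its mass is at
   most [M]. *)
Require Import Defs.
From HB Require Import structures.
From mathcomp Require Import all_boot all_order all_algebra.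
From mathcomp Require Import all_classical all_reals all_analysis.
From mathcomp Require Import finmap measurable_realfun ring lra.
Import Order.TTheory GRing.Theory Num.Theory.
Import numFieldNormedType.Exports.
Local Open Scope classical_set_scope.
Local Open Scope ring_scope.
Set Implicit Arguments. Unset Strict Implicit.

(** * Hahn-Banach: an additive functional below a sublinear one *)

Definition sublinear {R : realType} {V : lmodType R} (p : V -> R) :=
  (forall x y, p (x + y) <= p x + p y) /\
  (forall (t : R) x, 0 < t -> p (t *: x) <= t * p x).

Section hahn_banach.
Context {R : realType} {V : lmodType R}.
Implicit Types p q : V -> R.

Lemma sublinear0 p : sublinear p -> p 0 = 0.
Proof.
move=> [pD pZ]; have := pD 0 0; have := pZ (2^-1) 0.
by rewrite scaler0 addr0 invr_gt0 ltr0n => /(_ isT); lra.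
Qed.

(** The defining inequality at [t] and at [t^-1] together give equality, so the infima built below
    need only the one-sided bound. *)
Lemma sublinearZ p t x : sublinear p -> 0 <= t -> p (t *: x) = t * p x.
Proof.
move=> sp; rewrite le_eqVlt => /predU1P[<-|t0].
  by rewrite scale0r mul0r sublinear0.
apply/eqP; rewrite eq_le sp.2//=.
have := sp.2 t^-1 (t *: x); rewrite invr_gt0 => /(_ t0).
by rewrite scalerA mulVf ?gt_eqF// scale1r mulrC ler_pdivlMr// mulrC.
Qed.

Lemma sublinear_ge_opp p x y : sublinear p -> p y - p (- x) <= p (x + y).
Proof.
by move=> sp; have := sp.1 (- x) (x + y); rewrite addrA addNr add0r; lra.
Qed.

(** Zorn's lemma on the sublinear functionals below [p], where smaller functionals rank higher: the
    pointwise infimum of a nonempty chain is again sublinear. *)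
Lemma minimal_sublinear p : sublinear p -> exists q,
  [/\ sublinear q, forall x, q x <= p x &
      forall r, sublinear r -> (forall x, r x <= q x) -> r = q].
Proof.
move=> sp.
pose S := {q : V -> R | sublinear q /\ forall x, q x <= p x}.
pose ord (a b : S) := `[< forall x, sval b x <= sval a x >].
have [||||q qmax] := @Zorn S ord.
- by move=> t; apply/asboolP.
- move=> r s t /asboolP rs /asboolP st; apply/asboolP => x.
  exact: le_trans (st x) (rs x).
- move=> [s ps] [t pt] /asboolP st /asboolP ts; apply/eq_exist/funext => x.
  by apply/eqP; rewrite eq_le (st x) (ts x).
- move=> A Atot; have [[a0 Aa0]|A0] := pselect (exists a, A a); last first.
    exists (exist _ p (conj sp (fun x => lexx (p x)))) => s As.
    by exfalso; apply: A0; exists s.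
  pose E x := [set sval a x | a in A].
  (* Sublinearity gives [0 <= a x + a (- x)], and [a (- x) <= p (- x)]; this bound keeps the infimum
     finite. *)
  have Elb x : lbound (E x) (- p (- x)).
    move=> _ [[a [sa ap]] _ <-] /=.
    have := sublinear_ge_opp x 0 sa; rewrite addr0 (sublinear0 sa).
    by have := ap (- x); lra.
  have Einf x : has_inf (E x).
    by split; [exists (sval a0 x); exists a0 | exists (- p (- x))].
  pose q x := inf (E x).
  have qle a x : A a -> q x <= sval a x.
    by move=> Aa; apply: ge_inf; [exact: (Einf x).2 | exists a].
  have sq : sublinear q.
    split => [x y|t x t0].
      (* The chain condition enters here: the smaller of [a] and [b] serves at both [x] and [y]. *)
      have key a b : A a -> A b -> q (x + y) <= sval a x + sval b y.
        move=> Aa Ab; have [/asboolP ab|/asboolP ba] := Atot _ _ Aa Ab.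
          apply: le_trans (qle _ _ Ab) _.
          apply: le_trans ((proj2_sig b).1.1 _ _) _.
          by rewrite lerD2r ab.
        apply: le_trans (qle _ _ Aa) _.
        apply: le_trans ((proj2_sig a).1.1 _ _) _.
        by rewrite lerD2l ba.
      rewrite -lerBlDr; apply: lb_le_inf; first exact: (Einf x).1.
      move=> _ [a Aa <-]; rewrite lerBlDr -lerBlDl.
      apply: lb_le_inf; first exact: (Einf y).1.
      by move=> _ [b Ab <-]; rewrite lerBlDl key.
    rewrite mulrC -ler_pdivrMr//; apply: lb_le_inf; first exact: (Einf x).1.
    move=> _ [a Aa <-]; rewrite ler_pdivrMr// mulrC.
    exact: le_trans (qle _ _ Aa) ((proj2_sig a).1.2 _ _ t0).
  have qp x : q x <= p x := le_trans (qle a0 x Aa0) ((proj2_sig a0).2 x).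
  exists (exist _ q (conj sq qp)) => s As; apply/asboolP => x /=.
  exact: qle.
- case: q qmax => q [sq qp] qmax; exists q; split => // r sr rq.
  have rp x : r x <= p x by apply: le_trans (rq x) (qp x).
  have qr : ord (exist _ q (conj sq qp)) (exist _ r (conj sr rp)) by apply/asboolP.
  by case: (qmax _ qr).
Qed.

(* Minimality forces [q] to coincide with the sublinear functional
   [x |-> inf_(t >= 0) (q (x + t v) - t q v)], which at [t = 1] reads
   [q x + q v <= q (x + v)]. *)
Lemma minimal_sublinear_additive q : sublinear q ->
  (forall r, sublinear r -> (forall x, r x <= q x) -> r = q) ->
  forall x v, q (x + v) = q x + q v.
Proof.
move=> sq qmin x0 v; apply/eqP; rewrite eq_le sq.1/=.
pose E x := [set q (x + t *: v) - t * q v | t in [set t | 0 <= t]].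
have Elb x : lbound (E x) (- q (- x)).
  move=> _ [t t0 <-]; have := sublinear_ge_opp x (t *: v) sq.
  by rewrite (sublinearZ _ sq t0); lra.
have Einf x : has_inf (E x).
  split; last by exists (- q (- x)).
  by exists (q (x + 0 *: v) - 0 * q v); exists 0 => //=.
pose r x := inf (E x).
have rle x t : 0 <= t -> r x <= q (x + t *: v) - t * q v.
  by move=> t0; apply: ge_inf; [exact: (Einf x).2 | exists t].
have sr : sublinear r.
  split => [x y|s x s0].
    rewrite -lerBlDr; apply: lb_le_inf; first exact: (Einf x).1.
    move=> _ [t t0 <-]; rewrite lerBlDr -lerBlDl.
    apply: lb_le_inf; first exact: (Einf y).1.
    move=> _ [u u0 <-]; rewrite lerBlDr.
    apply: le_trans (rle _ (t + u) (addr_ge0 t0 u0)) _.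
    rewrite scalerDl addrACA mulrDl.
    by have := sq.1 (x + t *: v) (y + u *: v); lra.
  rewrite mulrC -ler_pdivrMr//; apply: lb_le_inf; first exact: (Einf x).1.
  move=> _ [t t0 <-]; rewrite ler_pdivrMr//.
  apply: le_trans (rle _ (s * t) (mulr_ge0 (ltW s0) t0)) _.
  rewrite -scalerA -scalerDr (sublinearZ _ sq (ltW s0)).
  by rewrite mulrBl -mulrA; lra.
have rq x : r x <= q x.
  by have := rle x 0 (lexx 0); rewrite scale0r addr0 mul0r subr0.
have := rle x0 1 ler01; rewrite (qmin _ sr rq) scale1r mul1r; lra.
Qed.

Lemma additive_below_sublinear p : sublinear p -> exists L : V -> R,
  (forall x y, L (x + y) = L x + L y) /\ (forall x, L x <= p x).
Proof.
move=> /minimal_sublinear[q [sq qp qmin]]; exists q; split => //.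
exact: minimal_sublinear_additive.
Qed.

End hahn_banach.

(** * From a finitely additive set function to a Borel measure *)

Section inner_outer_content.
Context {R : realType} {n : nat}.
Variable m : set 'rV[R]_n -> R.

Definition inner_content (A : set 'rV[R]_n) : \bar R :=
  ereal_sup [set (m C)%:E | C in [set C | compact C /\ C `<=` A]].

(** The outer measure of the Riesz representation theorem, with [inner_content] giving the mass of
    open sets. *)
Definition outer_content (A : set 'rV[R]_n) : \bar R :=
  ereal_inf [set inner_content U | U in [set U | open U /\ A `<=` U]].

Hypothesis m_ge0 : forall A, 0 <= m A.
Hypothesis mU : forall A B, A `&` B = set0 -> m (A `|` B) = m A + m B.

Lemma content0 : m set0 = 0.
Proof. by have := mU (setI0 set0); rewrite setU0; lra. Qed.

Lemma le_content A B : A `<=` B -> m A <= m B.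
Proof.
by move=> AB; rewrite -(setDUK AB) mU ?lerDl// setDE setICA setICr setI0.
Qed.

Lemma content_subadditive A B : m (A `|` B) <= m A + m B.
Proof.
rewrite -(setDUK (@subsetUl _ A B)) mU; last by rewrite setDE setICA setICr setI0.
by rewrite lerD2l le_content// => x [[]].
Qed.

Local Open Scope ereal_scope.

Lemma inner_content_ge C A : compact C -> C `<=` A -> (m C)%:E <= inner_content A.
Proof. by move=> cC CA; apply: ereal_sup_ubound; exists C. Qed.

Lemma inner_content_ge0 A : 0 <= inner_content A.
Proof.
apply: le_trans (inner_content_ge (@compact0 _) (@sub0set _ _)).
by rewrite lee_fin.
Qed.

Lemma inner_content_le A : inner_content A <= (m A)%:E.
Proof. by apply: ge_ereal_sup => _ [C [cC CA] <-]; rewrite lee_fin le_content. Qed.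

Lemma le_inner_content A B : A `<=` B -> inner_content A <= inner_content B.
Proof.
move=> AB; apply: ge_ereal_sup => _ [C [cC CA] <-].
exact: inner_content_ge (subset_trans CA AB).
Qed.

Lemma inner_content_fin A : inner_content A \is a fin_num.
Proof.
rewrite ge0_fin_numE ?inner_content_ge0//.
exact: le_lt_trans (inner_content_le A) (ltry _).
Qed.

(** By normality the disjoint closed sets [C \ V] and [C \ U] have disjoint open neighbourhoods;
    removing one or the other from [C] leaves the two pieces. *)
Lemma compact_subsetU (C U V : set 'rV[R]_n) : compact C -> open U -> open V ->
  C `<=` U `|` V -> exists C1 C2, [/\ compact C1, compact C2, C1 `<=` U,
    C2 `<=` V & C `<=` C1 `|` C2].
Proof.
move=> cC oU oV CUV.
have clC : closed C by apply: compact_closed => //; exact: norm_hausdorff.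
have clCD W : open W -> closed (C `\` W).
  by move=> oW; rewrite setDE; apply: closedI => //; exact: open_closedC.
have /(@normal_openP R) normal := @pseudometric_normal R 'rV[R]_n.
have [|U' [V' [oU' oV' CU' CV' UV']]] := normal _ _ (clCD V oV) (clCD U oU).
  by rewrite -subset0 => x [[Cx nVx] [_ nUx]]; case: (CUV x Cx).
exists (C `\` V'), (C `\` U'); split.
- by apply: subclosed_compact (clCD _ oV') cC _; exact: subDsetl.
- by apply: subclosed_compact (clCD _ oU') cC _; exact: subDsetl.
- by move=> x [Cx V'x]; apply: contrapT => nUx; apply: V'x; exact: CV'.
- by move=> x [Cx U'x]; apply: contrapT => nVx; apply: U'x; exact: CU'.
- move=> x Cx; have [V'x|] := pselect (V' x); [right|left] => //; split => // U'x.
  by suff : set0 x by []; rewrite -UV'.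
Qed.

Lemma inner_contentU U V : open U -> open V ->
  inner_content (U `|` V) <= inner_content U + inner_content V.
Proof.
move=> oU oV; apply: ge_ereal_sup => _ [C [cC CUV] <-].
have [C1 [C2 [cC1 cC2 C1U C2V CC12]]] := compact_subsetU cC oU oV CUV.
apply: (@le_trans _ _ ((m C1)%:E + (m C2)%:E)).
  by rewrite -EFinD lee_fin (le_trans (le_content CC12))// content_subadditive.
by apply: leeD; exact: inner_content_ge.
Qed.

(** A compact subset of the union lies in finitely many [U k], so finite subadditivity on open sets
    suffices. *)
Lemma inner_content_bigcup (U : (set 'rV[R]_n)^nat) : (forall k, open (U k)) ->
  inner_content (\bigcup_k U k) <= \sum_(k <oo) inner_content (U k).
Proof.
move=> oU.
have oUN N : open (\big[setU/set0]_(k < N) U k).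
  elim: N => [|N ih]; first by rewrite big_ord0; exact: open0.
  by rewrite big_ord_recr; exact: openU.
have UN N : inner_content (\big[setU/set0]_(k < N) U k) <=
    \sum_(0 <= k < N) inner_content (U k).
  elim: N => [|N ih].
    by rewrite big_ord0 big_geq// (le_trans (inner_content_le _))// content0.
  rewrite big_ord_recr big_nat_recr//=.
  by apply: le_trans (inner_contentU (oUN N) (oU N)) _; exact: leeD2r.
apply: ge_ereal_sup => _ [C [cC CU] <-].
have [D _ CD] : finite_subset_cover setT U C.
  by move: cC; rewrite compact_cover => /(_ nat setT U); apply.
pose N := (\max_(k <- D) k).+1.
apply: (@le_trans _ _ (inner_content (\big[setU/set0]_(k < N) U k))).
  apply: inner_content_ge => // x /CD[k /= kD Ukx]; rewrite -bigcup_mkord.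
  by exists k => //=; rewrite ltnS; exact: leq_bigmax_seq.
apply: le_trans (UN N) _; apply: nneseries_lim_ge => *.
exact: inner_content_ge0.
Qed.

Lemma outer_content_open U : open U -> outer_content U = inner_content U.
Proof.
move=> oU; apply/eqP; rewrite eq_le; apply/andP; split.
  by apply: ereal_inf_lbound; exists U => //; split.
by apply: le_ereal_inf_tmp => _ [V [oV UV] <-]; exact: le_inner_content.
Qed.

Lemma outer_content_le_open A U : open U -> A `<=` U ->
  outer_content A <= inner_content U.
Proof. by move=> oU AU; apply: ereal_inf_lbound; exists U. Qed.

Lemma le_outer_content A B : A `<=` B -> outer_content A <= outer_content B.
Proof.
move=> AB; apply: le_ereal_inf_tmp => _ [U [oU BU] <-].
exact: outer_content_le_open (subset_trans AB BU).
Qed.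

Lemma outer_content_ge0 A : 0 <= outer_content A.
Proof. by apply: le_ereal_inf_tmp => _ [U _ <-]; exact: inner_content_ge0. Qed.

Lemma outer_contentT_le : outer_content setT <= (m setT)%:E.
Proof. by rewrite outer_content_open ?inner_content_le//; exact: openT. Qed.

Lemma outer_content_fin A : outer_content A \is a fin_num.
Proof.
rewrite ge0_fin_numE ?outer_content_ge0//.
apply: le_lt_trans (ltry (m setT)).
exact: le_trans (le_outer_content (@subsetT _ A)) outer_contentT_le.
Qed.

Lemma outer_content_adherent A (e : R) : (0 < e)%R ->
  exists U, [/\ open U, A `<=` U & inner_content U <= outer_content A + e%:E].
Proof.
move=> e0; have [_ [U [oU AU] <-] /ltW Ue] :=
  lb_ereal_inf_adherent e0 (outer_content_fin A).
by exists U.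
Qed.

(** This carries the covering inequality from [m] over to the measure, since translates of [T] are
    compact. *)
Lemma outer_content_ge_compact C : compact C -> (m C)%:E <= outer_content C.
Proof.
by move=> cC; apply: le_ereal_inf_tmp => _ [U [oU CU] <-]; exact: inner_content_ge.
Qed.

Lemma outer_content0 : outer_content set0 = 0.
Proof.
apply/eqP; rewrite eq_le outer_content_ge0 andbT outer_content_open; last exact: open0.
by rewrite (le_trans (inner_content_le _))// content0.
Qed.

Lemma outer_content_sigma_subadditive : sigma_subadditive outer_content.
Proof.
move=> F; apply/lee_addgt0Pr => e e0.
have /choice[U FU] : forall k, exists U, [/\ open U, F k `<=` U &
    inner_content U <= outer_content (F k) + (e / (2 ^ k.+1)%:R)%:E].
  move=> k; apply: outer_content_adherent.
  by rewrite divr_gt0// ltr0n expn_gt0.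
apply: (@le_trans _ _ (inner_content (\bigcup_k U k))).
  apply: outer_content_le_open.
    by apply: bigcup_open => k _; have [] := FU k.
  by apply: subset_bigcup => k _; have [] := FU k.
apply: le_trans (inner_content_bigcup (fun k => let: And3 o _ _ := FU k in o)) _.
apply: le_trans (epsilon_trick _ (fun k => outer_content_ge0 (F k)) (ltW e0)).
apply: lee_nneseries => [k _ _|k _]; first exact: inner_content_ge0.
by have [] := FU k.
Qed.

(* A compact set nearly exhausting [V `&` U] leaves an open remainder
   [V `\` C] that contains [V `\` U]. *)
Lemma outer_content_split_open V U : open V -> open U ->
  outer_content (V `&` U) + outer_content (V `\` U) <= inner_content V.
Proof.
move=> oV oU; apply/lee_addgt0Pr => e e0.
have e20 : (0 < e / 2)%R by rewrite divr_gt0.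
have [_ [C [cC CVU] <-] /ltW Ce] :=
  ub_ereal_sup_adherent e20 (inner_content_fin (V `&` U)).
have clC : closed C by apply: compact_closed => //; exact: norm_hausdorff.
have [_ [D [cD DVC] <-] /ltW De] :=
  ub_ereal_sup_adherent e20 (inner_content_fin (V `\` C)).
rewrite -/(inner_content _) in Ce; rewrite -/(inner_content _) in De.
have CD0 : C `&` D = set0 by rewrite -subset0 => x [Cx /DVC[_]].
have mCD : (m C)%:E + (m D)%:E <= inner_content V.
  rewrite -EFinD -mU//; apply: inner_content_ge; first exact: compactU.
  by move=> x [/CVU[]//|/DVC[]].
have UV : outer_content (V `&` U) <= inner_content (V `&` U).
  by apply: outer_content_le_open => //; exact: openI.
have VC : outer_content (V `\` U) <= inner_content (V `\` C).
  apply: outer_content_le_open.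
    by rewrite setDE; apply: openI => //; exact: closed_openC.
  by move=> x [Vx nUx]; split => // /CVU[].
rewrite leeBlDr// in Ce; rewrite leeBlDr// in De.
apply: le_trans (leeD UV VC) _; apply: le_trans (leeD Ce De) _.
by rewrite addeACA -[X in _ + X]EFinD -splitr; exact: leeD2r.
Qed.
(** Open sets satisfy the Caratheodory condition, so the Borel sigma-algebra lies in the
    Caratheodory one, where the outer measure is sigma-additive. *)
Lemma content_measure : exists mu : {measure set (Rn R n) -> \bar R},
  forall A, mu A = outer_content A.
Proof.
pose omi := isOuterMeasure.Build R 'rV[R]_n outer_content outer_content0
  outer_content_ge0 le_outer_content outer_content_sigma_subadditive.
pose om : {outer_measure set 'rV[R]_n -> \bar R} := HB.pack outer_content omi.
have open_cara U : open U -> om.-caratheodory U.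
  move=> oU; apply: le_caratheodory_measurable => X.
  (* The test set [X] may be replaced by any open [V] containing it, as [outer_content X] is the
     infimum over these. *)
  apply: le_ereal_inf_tmp => _ [V [oV XV] <-].
  apply: le_trans (outer_content_split_open oV oU).
  by apply: leeD; apply: le_outer_content => x [/XV].
have meas_cara (A : set (Rn R n)) : measurable A -> om.-caratheodory A.
  move: A; apply: smallest_sub => //.
  exact: (@sigma_algebra_measurable _ (caratheodory_type om)).
have sadd : semi_sigma_additive (outer_content : set (Rn R n) -> \bar R).
  move=> F mF tF mUF; apply: (@caratheodory_measure_sigma_additive _ _ om) => //.
    by move=> k; exact: meas_cara.
  exact: meas_cara.
pose mi := isMeasure.Build _ (Rn R n) R outer_content outer_content0
  outer_content_ge0 sadd.
by exists (HB.pack outer_content mi : {measure set (Rn R n) -> \bar R}).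
Qed.

End inner_outer_content.

(** * Regularity of finite Borel measures, and discrete measures *)

Section borel_measures.
Context {R : realType} {n : nat}.
Implicit Types (mu : {measure set (Rn R n) -> \bar R}) (A C T : set 'rV[R]_n).
Local Open Scope ereal_scope.

Lemma open_Rn_measurable A : open A -> measurable (A : set (Rn R n)).
Proof. by move=> oA; exact: sub_sigma_algebra. Qed.

Lemma closed_Rn_measurable A : closed A -> measurable (A : set (Rn R n)).
Proof.
move=> cA; rewrite -[A]setCK; apply: measurableC.
by apply: open_Rn_measurable; exact: closed_openC.
Qed.

Lemma compact_Rn_measurable C : compact C -> measurable (C : set (Rn R n)).
Proof.
move=> cC; apply: closed_Rn_measurable.
by apply: compact_closed => //; exact: norm_hausdorff.
Qed.

Lemma le_Rn_measure mu (A B : set (Rn R n)) : measurable A -> measurable B ->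
  A `<=` B -> mu A <= mu B.
Proof. by move=> mA mB; apply: le_measure; exact: mem_set. Qed.

(** Continuity from below along the intersections of [A] with the closed balls of radius [k], which
    are compact. *)
Lemma closed_measure_le_compact mu A x : closed A ->
  (forall C, compact C -> C `<=` A -> mu C <= x) -> mu A <= x.
Proof.
move=> clA Ax.
pose B k : set 'rV[R]_n := [set v | (`|v| <= k%:R)%R].
have clB k : closed (B k).
  have -> : B k = (fun v : 'rV[R]_n => `|v|%R) @^-1` [set y : R | y <= k%:R]%R by [].
  apply: preimage_closed => [v _|].
    exact: norm_continuous.
  exact: closed_le.
have cAB k : compact (A `&` B k).
  apply: bounded_closed_compact; last exact: closedI.
  exists k%:R; split; first exact: num_real.
  by move=> y ky v [_ vk]; exact: le_trans vk (ltW ky).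
have AB : A = \bigcup_k (A `&` B k).
  rewrite -setI_bigcupr setIidl// => v Av; exists (Num.bound `|v|%R) => //.
  by rewrite /B /= ltW// archi_boundP.
rewrite AB; have mAB k := compact_Rn_measurable (cAB k).
have mUAB : measurable (\bigcup_k (A `&` B k) : set (Rn R n)).
  exact: bigcup_measurable.
have ndAB : nondecreasing_seq (fun k => A `&` B k : set (Rn R n)).
  move=> i j ij; apply/subsetPset => v [Av vi]; split => //.
  by apply: le_trans vi _; rewrite ler_nat.
have cvgAB := @nondecreasing_cvg_mu _ _ _ mu _ mAB mUAB ndAB.
rewrite -(cvg_lim _ cvgAB)//; apply: lime_le; first by apply/cvg_ex; eexists; exact: cvgAB.
by near=> k; apply: Ax.
Unshelve. all: by end_near. Qed.

(** Inner regularity of [A] is outer regularity of its complement: if [U] is open around [~]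
    A[, then]~[U] is a closed subset of [A] of nearly full mass, and compact sets exhaust it. *)
Lemma outer_regular_regular mu : mu setT < +oo ->
  (forall A, measurable (A : set (Rn R n)) -> forall e : R, (0 < e)%R ->
     exists U, [/\ open U, A `<=` U & mu U <= mu A + e%:E]) ->
  regular_measure mu.
Proof.
move=> muT outer A mA.
have mfin B : measurable B -> mu B \is a fin_num.
  move=> mB; rewrite ge0_fin_numE//; apply: le_lt_trans muT.
  by apply: le_Rn_measure => //.
split; apply/eqP; rewrite eq_le; apply/andP; split.
- apply: le_ereal_inf_tmp => _ [U [oU AU] <-].
  by apply: le_Rn_measure => //; exact: open_Rn_measurable.
- apply/lee_addgt0Pr => e /(outer _ mA)[U [oU AU Ue]].
  by apply: le_trans Ue; apply: ereal_inf_lbound; exists U.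
- apply/lee_addgt0Pr => e /(outer _ (measurableC mA))[U [oU AU Ue]].
  have mU := open_Rn_measurable oU.
  have UA : ~` U `<=` A by move=> x; apply: contra_notP => nAx; exact: AU.
  (* [U] is the disjoint union of [~] A[and]A [&] U[; cancelling the finite]mu (~[A)] leaves [e]. *)
  have AUe : mu (A `&` U) <= e%:E.
    rewrite -(@leeD2lE _ (mu (~` A))) ?mfin//; last exact: measurableC.
    apply: le_trans Ue; rewrite -measureU//.
    + apply: le_Rn_measure => //.
        by apply: measurableU; [exact: measurableC|exact: measurableI].
      by move=> x [/AU|[]].
    + exact: measurableC.
    + exact: measurableI.
    + by rewrite setIA setICl set0I.
  rewrite (measureDI mu mA mU); apply: leeD => //.
  have -> : A `\` U = ~` U by rewrite setDE setIidr.
  apply: closed_measure_le_compact; first exact: open_closedC.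
  move=> C cC CU; apply: ereal_sup_ubound; exists C => //; split => //.
  exact: subset_trans CU UA.
- apply: ge_ereal_sup => _ [C [cC CA] <-].
  by apply: le_Rn_measure => //; exact: compact_Rn_measurable.
Qed.

Lemma rV_subl_continuous (x : 'rV[R]_n) :
  continuous (fun y : 'rV[R]_n => x - y)%R.
Proof. by move=> y; apply: continuousB; [exact: cst_continuous|exact: id]. Qed.

Lemma closed_sub_preimage T x : closed T -> closed [set y : 'rV[R]_n | T (x - y)%R].
Proof.
have -> : [set y : 'rV[R]_n | T (x - y)%R] = (fun y => x - y)%R @^-1` T by [].
move=> cT; apply: preimage_closed => // y _.
exact: rV_subl_continuous.
Qed.

Lemma conv_indicE mu T x : closed T ->
  conv_indic mu T x = mu [set y | T (x - y)%R].
Proof.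
move=> cT; rewrite -[X in mu X]setIT -integral_indic//.
by apply: closed_Rn_measurable; exact: closed_sub_preimage.
Qed.

Lemma discrete_measure (s : seq (R * 'rV[R]_n)) : discrete_nonneg s ->
  exists mu, forall A, mu A = (dmass s A)%:E.
Proof.
elim: s => [_|[w x] s ih s0].
  by exists mzero => A; rewrite /dmass big_nil.
have [p ps|mu muE] := ih; first by apply: s0; rewrite in_cons ps orbT.
have w0 : (0 <= w)%R by apply: (s0 (w, x)); rewrite mem_head.
exists (measure_add (mscale (NngNum w0) (dirac (x : Rn R n))) mu) => A.
by rewrite [LHS](@measure_addE _ _ _ _ mu) muE /dmass big_cons EFinD.
Qed.

(** Deleting from the space the finitely many atoms outside [A] leaves an open set around [A] with
    no additional mass. *)
Lemma discrete_measure_regular mu (s : seq (R * 'rV[R]_n)) : discrete_nonneg s ->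
  (forall A, mu A = (dmass s A)%:E) -> regular_measure mu.
Proof.
move=> s0 muE; apply: outer_regular_regular; first by rewrite muE ltry.
move=> A mA e e0.
pose F := [set` [seq p.2 | p <- s & p.2 \notin A]].
exists (~` F); split.
- apply: closed_openC; apply: compact_closed; first exact: norm_hausdorff.
  by apply: finite_compact; exact: finite_seq.
- move=> x Ax /= /mapP[p]; rewrite mem_filter => /andP[+ _] xp.
  by rewrite -xp notin_setE; apply.
- rewrite !muE -EFinD lee_fin ler_wpDr ?(ltW e0)//.
  rewrite /dmass big_seq [leRHS]big_seq.
  apply: ler_sum => p ps; rewrite ler_wpM2l ?s0// !indicE.
  have [pA|pA] := boolP (p.2 \in A); first by case: (_ \in _).
  rewrite memNset// => /=; apply; apply/mapP; exists p => //.
  by rewrite mem_filter pA.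
Qed.

Lemma le_Momega_Mstar K T : closed T -> Momega K T <= Mstar K T.
Proof.
move=> cT; apply: ge_ereal_sup => _ [s [s0 sT] <-].
have [mu muE] := discrete_measure s0.
apply: ereal_sup_ubound; exists mu => //; split.
  exact: discrete_measure_regular muE.
by move=> x; rewrite conv_indicE// muE lee_fin; exact: sT.
Qed.

End borel_measures.

(** * The vector space of functions with finitely many values *)

Section fimfun_lmodule.
Context {T : pointedType} {R : realType}.
Implicit Types f g : {fimfun T >-> R}.

Let fimfun_scalerA (a b : R) f :
  scale_fimfun a (scale_fimfun b f) = scale_fimfun (a * b) f.
Proof. by apply/fimfuneqP => x /=; ring. Qed.

Let fimfun_scale1r : left_id 1 (@scale_fimfun T R).
Proof. by move=> f; apply/fimfuneqP => x /=; ring. Qed.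

Let fimfun_scalerDr : right_distributive (@scale_fimfun T R) +%R.
Proof. by move=> a f g; apply/fimfuneqP => x; exact: mulrDl. Qed.

Let fimfun_scalerDl f : {morph (@scale_fimfun T R)^~ f : a b / a + b}.
Proof. by move=> a b; apply/fimfuneqP => x; exact: mulrDr. Qed.

(** This space contains the indicator of every subset, measurable or not, so a functional on it
    yields a set function on all subsets; its members are bounded. *)
HB.instance Definition _ := GRing.Zmodule_isLmodule.Build R {fimfun T >-> R}
  fimfun_scalerA fimfun_scale1r fimfun_scalerDr fimfun_scalerDl.

Lemma fimfun_scaleE (a : R) f x : (a *: f) x = a * f x.
Proof. exact: mulrC. Qed.

Lemma fimfun_bounded f : exists b : R, forall x, `|f x| <= b.
Proof.
have /finite_seqP[s fs] := fimfunP f.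
exists (\big[Num.max/0]_(y <- s) `|y|) => x.
by apply: le_bigmax_seq => //; have : [set` s] (f x) by rewrite -fs; exists x.
Qed.

End fimfun_lmodule.

Lemma indic_disjointU {T : Type} {R : realType} (A B : set T) (x : T) :
  A `&` B = set0 -> \1_(A `|` B) x = \1_A x + \1_B x :> R.
Proof.
move=> AB; rewrite !indicE in_setU.
have [xA|xA] := boolP (x \in A); have [xB|xB] := boolP (x \in B);
  rewrite ?addr0 ?add0r//=.
by suff : set0 x by []; rewrite -AB; split; exact: set_mem.
Qed.

(** * Strong duality at the level of finitely additive set functions *)

Section dual_content.
Context {R : realType} {n : nat}.
Variables (K T : set 'rV[R]_n) (M : R).
Hypothesis ME : Momega K T = M%:E.
Implicit Types (s : seq (R * 'rV[R]_n)) (f g : {fimfun 'rV[R]_n >-> R}).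

Let scale_seq (t : R) s := [seq (t * p.1, p.2) | p <- s].

Lemma dmass_scale t s A : dmass (scale_seq t s) A = t * dmass s A.
Proof.
by rewrite /dmass big_map mulr_sumr; apply: eq_bigr => p _; rewrite mulrA.
Qed.

Lemma dconv_indic_scale t s A x :
  dconv_indic (scale_seq t s) A x = t * dconv_indic s A x.
Proof.
by rewrite /dconv_indic big_map mulr_sumr; apply: eq_bigr => p _; rewrite mulrA.
Qed.

Lemma discrete_nonneg_scale t s : 0 <= t -> discrete_nonneg s ->
  discrete_nonneg (scale_seq t s).
Proof. by move=> t0 s0 _ /mapP[p ps ->]; rewrite mulr_ge0// s0. Qed.

Lemma discrete_nonneg_cat s1 s2 : discrete_nonneg s1 -> discrete_nonneg s2 ->
  discrete_nonneg (s1 ++ s2).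
Proof. by move=> h1 h2 p; rewrite mem_cat => /orP[/h1|/h2]. Qed.

Lemma dconv_indic_ge0 s A x : discrete_nonneg s -> 0 <= dconv_indic s A x.
Proof.
by move=> s0; rewrite /dconv_indic big_seq sumr_ge0// => p /s0 p0; rewrite mulr_ge0.
Qed.

Lemma Momega_ge0 : 0 <= M.
Proof.
rewrite -lee_fin -ME; apply: ereal_sup_ubound; exists [::].
  by split => // x; rewrite /dconv_indic big_nil ler01.
by rewrite /dmass big_nil.
Qed.

(** Dividing the weights by [c] gives a packing. As [c] may be zero, the division is by a positive
    [d >= c], and [d] then tends to [c]. *)
Lemma dmass_le_Momega s c : discrete_nonneg s ->
  (forall y, dconv_indic s T y <= c) -> dmass s K <= M * c.
Proof.
move=> s0 sc.
have c0 : 0 <= c by apply: le_trans (sc 0); exact: dconv_indic_ge0.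
have key d : 0 < d -> c <= d -> dmass s K <= M * d.
  move=> d0 cd; rewrite -ler_pdivrMr// mulrC -dmass_scale -lee_fin -ME.
  apply: ereal_sup_ubound; exists (scale_seq d^-1 s) => //; split.
    by apply: discrete_nonneg_scale; rewrite // invr_ge0 ltW.
  move=> y; rewrite dconv_indic_scale mulrC ler_pdivrMr// mul1r.
  exact: le_trans (sc y) cd.
apply/ler_addgt0Pr => e e0.
(* [M] may vanish, hence the increment [e / (M + 1)], for which [M * (e / (M + 1)) <= e]. *)
have M1 : 0 < M + 1 by have := Momega_ge0; lra.
have e1 : 0 < e / (M + 1) by rewrite divr_gt0.
have /le_trans := key (c + e / (M + 1)) ltac:(lra) ltac:(lra).
apply; rewrite mulrDr lerD2l mulrA ler_pdivrMr//; nra.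
Qed.

(* Linear functionals below [p] are nonnegative, at most [M] at [1], and at
   least [1] at the indicator of [x + T] for [x] in [K]; that [p] is finite
   says exactly that [M] bounds all weighted packings. *)
Let E f := [set M * cs.1 - dmass cs.2 K | cs in
  [set cs : R * seq (R * 'rV[R]_n) | discrete_nonneg cs.2 /\
     forall y, f y + dconv_indic cs.2 T y <= cs.1]].

Let p f := inf (E f).

(** If [|f| <= b], the pair [(b, [::])] is admissible; and any admissible [(c, s)] has its
    convolution at most [c + b], so [s] gives [K] mass at most [M * (c + b)]. *)
Let E_has_inf f : has_inf (E f).
Proof.
have [b fb] := fimfun_bounded f; split.
  exists (M * b - dmass [::] K), (b, [::]) => //=; split => // y.
  by rewrite /dconv_indic big_nil addr0 (le_trans (ler_norm _)).
exists (- (M * b)) => _ [[c s] /= [s0 fsc] <-].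
suff : dmass s K <= M * (c + b) by rewrite mulrDr; lra.
apply: dmass_le_Momega => // y.
by have := fsc y; have := fb y; rewrite ler_norml => /andP[]; lra.
Qed.

Let p_le f c s : discrete_nonneg s ->
  (forall y, f y + dconv_indic s T y <= c) -> p f <= M * c - dmass s K.
Proof.
move=> s0 fsc; apply: ge_inf; first exact: (E_has_inf f).2.
by exists (c, s).
Qed.

(** Admissible pairs for [f] and [g] add up, by concatenating the lists, to one for [f + g], and
    they scale with [f]. *)
Let p_sublinear : sublinear p.
Proof.
split => [f g|t f t0].
  rewrite -lerBlDr; apply: lb_le_inf; first exact: (E_has_inf f).1.
  move=> _ [[c s] /= [s0 fsc] <-]; rewrite lerBlDr -lerBlDl.
  apply: lb_le_inf; first exact: (E_has_inf g).1.
  move=> _ [[d u] /= [u0 gud] <-]; rewrite lerBlDl.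
  apply: le_trans (@p_le (f + g) (c + d) (s ++ u) _ _) _.
  - exact: discrete_nonneg_cat.
  - move=> y; rewrite /dconv_indic big_cat/= addrACA.
    by apply: lerD; [exact: fsc|exact: gud].
  - by rewrite /dmass big_cat/=; lra.
rewrite mulrC -ler_pdivrMr//; apply: lb_le_inf; first exact: (E_has_inf f).1.
move=> _ [[c s] /= [s0 fsc] <-]; rewrite ler_pdivrMr//.
apply: le_trans (@p_le (t *: f) (t * c) (scale_seq t s) _ _) _.
- by apply: discrete_nonneg_scale => //; exact: ltW.
- by move=> y; rewrite fimfun_scaleE dconv_indic_scale -mulrDr ler_pM2l.
- by rewrite dmass_scale; lra.
Qed.

(** The set function is [L] on indicators, and each bound on it comes from one admissible pair: [(0,
    [::])] for nonnegativity, [(1, [::])] for the total mass, a unit mass at [x] for the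
    covering. *)
Lemma exists_dual_content : exists m : set 'rV[R]_n -> R,
  [/\ forall A, 0 <= m A,
      forall A B, A `&` B = set0 -> m (A `|` B) = m A + m B,
      m setT <= M &
      forall x, K x -> 1 <= m [set y | T (y - x)]].
Proof.
have [L [LD Lp]] := additive_below_sublinear p_sublinear.
have L0 : L 0 = 0 by have := LD 0 0; rewrite addr0; lra.
have LN f : L (- f) = - L f by have := LD f (- f); rewrite subrr L0; lra.
exists (fun A => L (indic_fimfun A)); split => [A|A B AB||x Kx].
- rewrite -oppr_le0 -LN; apply: le_trans (Lp _) _.
  apply: le_trans (@p_le _ 0 [::] _ _) _ => // [y|].
    by rewrite /dconv_indic big_nil addr0 /= oppr_le0.
  by rewrite /dmass big_nil mulr0 subr0.
- by rewrite -LD; congr L; apply/fimfuneqP => x; exact: indic_disjointU.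
- apply: le_trans (Lp _) _; apply: le_trans (@p_le _ 1 [::] _ _) _ => // [y|].
    by rewrite /dconv_indic big_nil addr0 /= indicE; case: (_ \in _).
  by rewrite /dmass big_nil mulr1 subr0.
(* The convolution of the unit mass at [x] cancels minus the indicator of [x + T], so [c = 0] is
   admissible; since [x] is in [K], the value of the pair is [-1]. *)
- rewrite -lerN2 -LN; apply: le_trans (Lp _) _.
  apply: le_trans (@p_le _ 0 [:: (1, x)] _ _) _.
  + by move=> q; rewrite inE => /eqP ->.
  + by move=> y; rewrite /dconv_indic big_seq1 /= mul1r addNr.
  + by rewrite /dmass big_seq1 /= indicE mem_set// mulr0 mulr1 sub0r.
Qed.

End dual_content.

(** * Reflection of [T], and strong duality for measures *)

Section reflection.
Context {R : realType} {n : nat}.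
Implicit Types (T : set 'rV[R]_n) (x : 'rV[R]_n).

Lemma reflectE T : [set - t | t in T] = (fun y => - y) @^-1` T.
Proof.
apply/seteqP; split => [_ [t Tt <-]|y Ty]; first by rewrite /preimage/= opprK.
by exists (- y) => //; rewrite opprK.
Qed.

Lemma closed_reflect T : closed T -> closed [set - t | t in T].
Proof.
by move=> cT; rewrite reflectE; apply: preimage_closed => // y _; exact: opp_continuous.
Qed.

(** Covering by [-T] at [x] is thus a condition on the mass of [x + T]. *)
Lemma reflect_translateE T x :
  [set y | [set - t | t in T] (x - y)] = [set y | T (y - x)].
Proof. by rewrite reflectE; apply/seteqP; split => y /=; rewrite opprB. Qed.

Lemma compact_translate T x : compact T -> compact [set y | T (y - x)].
Proof.
move=> cT; have -> : [set y | T (y - x)] = (fun t => t + x) @` T.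
  apply/seteqP; split => [y Ty|_ [t Tt <-]]; last by rewrite /= addrK.
  by exists (y - x) => //; rewrite subrK.
apply: continuous_compact => //; apply: continuous_subspaceT => t.
by apply: continuousD; [exact: id|exact: cst_continuous].
Qed.

End reflection.

Lemma Nstar_reflect_le_Momega {R : realType} {n : nat} (K T : set 'rV[R]_n) :
  compact T -> (Nstar K [set (- t)%R | t in T] <= Momega K T)%E.
Proof.
move=> cT; case ME : (Momega K T) => [M| |]; last 2 first.
- exact: leey.
(* The value [-oo] is excluded by the empty packing, of mass zero. *)
- suff : (0 <= Momega K T)%E by rewrite ME.
  apply: ereal_sup_ubound; exists [::].
    by split => // x; rewrite /dconv_indic big_nil ler01.
  by rewrite /dmass big_nil.
have [m [m0 mU mT mK]] := exists_dual_content ME.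
have [mu muE] := content_measure m0 mU.
have muT : (mu setT <= M%:E)%E.
  by rewrite muE (le_trans (outer_contentT_le m0 mU))// lee_fin.
apply: le_trans muT; apply: ereal_inf_lbound; exists mu => //; split.
  apply: outer_regular_regular => [|A mA e e0].
    by rewrite muE -ge0_fin_numE ?outer_content_fin ?outer_content_ge0.
  have [U [oU AU Ue]] := outer_content_adherent m0 mU A e0.
  by exists U; split; rewrite // !muE outer_content_open.
have clT : closed T by apply: compact_closed => //; exact: norm_hausdorff.
move=> x; rewrite (conv_indicE _ _ (closed_reflect clT)) reflect_translateE muE.
rewrite indicE; have [/set_mem Kx|_] := boolP (x \in K).
  apply: le_trans (outer_content_ge_compact _ _); last exact: compact_translate.
  by rewrite lee_fin mK.
exact: outer_content_ge0.
Qed.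

(** * Measurability of the relation [y - x \in T] in the product sigma-algebra *)

Section difference_measurable.
Context {R : realType} {n : nat}.

(** The norm is the maximum norm, so coordinates are approximated separately. Rational centres keep
    the union of rectangles below countable. *)
Lemma dense_rat_rV (x : 'rV[R]_n) (e : R) : 0 < e ->
  exists r : 'rV[rat]_n, `|x - map_mx ratr r| < e.
Proof.
move=> e0.
have /choice[r rx] : forall j, exists q : rat, `|x ord0 j - ratr q| < e.
  move=> j; have [|q] := @rat_in_itvoo R (x ord0 j - e) (x ord0 j + e).
    by lra.
  by rewrite in_itv/= => /andP[qe eq]; exists q; rewrite ltr_norml; apply/andP; lra.
exists (\row_j r j).
suff : ball x e (map_mx ratr (\row_j r j)) by rewrite -ball_normE.
by split => // i j; rewrite !ord1 !mxE -ball_normE; exact: rx.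
Qed.

(* [y - x \in T] iff for every [k] some rational [q] has [x] within [1/(k+1)]
   of [q] and [y] within [1/(k+1)] of [q + T]: only rectangles are needed. *)
Lemma measurable_difference (T : set 'rV[R]_n) : closed T ->
  measurable [set z : Rn R n * Rn R n | T ((z.2 : 'rV[R]_n) - z.1)].
Proof.
move=> cT.
pose q (r : 'rV[rat]_n) : 'rV[R]_n := map_mx ratr r.
pose e k : R := k.+1%:R^-1.
have e0 k : 0 < e k by rewrite invr_gt0.
pose A k r : set (Rn R n) := ball (q r) (e k).
pose B k r : set (Rn R n) := \bigcup_(t in T) ball (q r + t) (e k).
have -> : [set z : Rn R n * Rn R n | T ((z.2 : 'rV[R]_n) - z.1)] =
    \bigcap_k \bigcup_r (A k r `*` B k r).
  apply/seteqP; split => [[x y] /= Txy k _|[x y] xy /=].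
    have [r xr] := dense_rat_rV x (e0 k).
    exists r => //; split => /=; first by rewrite /A -ball_normE /= distrC.
    exists (y - x) => //; rewrite -ball_normE /=.
    by rewrite addrA addrAC addrK -normrN opprB.
  rewrite (closure_id T).1// => C /nbhs_ballP[d /= d0 dC].
  have d20 : 0 < d / 2 by rewrite divr_gt0.
  have [k _ /(_ k (leqnn k)) /= kd] := near_infty_natSinv_lt (PosNum d20).
  have [r _ [/= xr [t Tt yt]]] := xy k I.
  exists t; split => //; apply: dC; rewrite -ball_normE /=.
  move: xr yt; rewrite /A -!ball_normE /= => xr yt.
  (* The error splits into those of [x] and of [y] relative to the common centre [q r], each less
     than [e k < d / 2]. *)
  have -> : y - x - t = (q r - x) - (q r + t - y) 
    by rewrite opprB opprD !addrA [_ - x + y]addrAC [q r + y]addrC [_ - x - q r]addrAC addrK.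
  have {}kd : e k < d / 2 by exact: kd.
  by apply: le_lt_trans (ler_normB _ _) _; lra.
apply: bigcap_measurable => // k _; apply: countable_bigcupT_measurable => [|r].
  exact: countableP.
apply: measurableX; apply: open_Rn_measurable; first exact: ball_open.
by apply: bigcup_open => t _; exact: ball_open.
Qed.

End difference_measurable.

(** * Double counting by Tonelli's theorem *)

Section section_double_counting.
Context d1 d2 (T1 : measurableType d1) (T2 : measurableType d2) (R : realType).
Local Open Scope ereal_scope.

Lemma section_double_counting (mu : {measure set T1 -> \bar R})
    (nu : {measure set T2 -> \bar R}) (K : set T1) (W : set (T1 * T2)) :
  measurable K -> mu K < +oo -> nu setT < +oo -> measurable W ->
  (forall y, mu (ysection W y) <= 1) ->
  (forall x, K x -> 1 <= nu (xsection W x)) -> mu K <= nu setT.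
Proof.
move=> mK muoo nuoo mW muW nuW.
(* [mu] is known to be finite only on [K]; restricting it there makes both measures finite, as
   needed to exchange the integrals. *)
pose m1 := mfrestr mK muoo; pose m2 := mfrestr measurableT nuoo.
pose f z := (\1_W z : R)%:E.
have mf : measurable_fun setT f by apply/measurable_EFinP; exact: measurable_indic.
have f0 z : 0 <= f z by rewrite lee_fin.
have F_ge x : (\1_K x)%:E <= \int[m2]_y f (x, y).
  have -> : \int[m2]_y f (x, y) = \int[m2]_y (\1_(xsection W x) y)%:E.
    by apply: eq_integral => y _; rewrite /f !indicE mem_xsection.
  rewrite integral_indic//; last exact: measurable_xsection.
  rewrite /= /mfrestr /mrestr !setIT indicE.
  by have [/set_mem Kx|_] := boolP (x \in K); [exact: nuW|exact: measure_ge0].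
have G_le y : \int[m1]_x f (x, y) <= 1.
  have -> : \int[m1]_x f (x, y) = \int[m1]_x (\1_(ysection W y) x)%:E.
    by apply: eq_integral => x _; rewrite /f !indicE mem_ysection.
  have mWy := measurable_ysection y mW.
  rewrite integral_indic//= /mfrestr /mrestr setIT; apply: le_trans (muW y).
  by apply: le_measure; [exact/mem_set/measurableI|exact: mem_set|exact: subIsetl].
have -> : mu K = \int[m1]_x (\1_K x)%:E.
  by rewrite integral_indic//= /mfrestr /mrestr setIT setIid.
have -> : nu setT = \int[m2]_y 1.
  by rewrite integral_cst//= mul1e /mfrestr /mrestr setIT.
apply: (@le_trans _ _ (\int[m1]_x \int[m2]_y f (x, y))).
  apply: ge0_le_integral => //.
  - by apply/measurable_EFinP; exact: measurable_indic.
  - exact: measurable_fun_fubini_tonelli_F.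
rewrite fubini_tonelli//; apply: ge0_le_integral => //.
- by move=> y _; exact: integral_ge0.
- exact: measurable_fun_fubini_tonelli_G.
Qed.

End section_double_counting.

(** * Weak duality between packings and coverings *)

Section weak_duality.
Context {R : realType} {n : nat}.
Implicit Types (mu nu : {measure set (Rn R n) -> \bar R}) (K T : set 'rV[R]_n).
Local Open Scope ereal_scope.

(** Since [T] has interior, finitely many translates of [-T] cover the compact [K], and each has
    mass at most [1]. *)
Lemma packing_compact_lty mu K T : compact K -> closed T -> T° !=set0 ->
  (forall x, mu [set y | T (x - y)%R] <= 1) -> mu K < +oo.
Proof.
move=> cK cT [t0 Tt0] muT.
(* The shift by the interior point [t0] places [x] in the open set [G x], so the sets [G x] cover
   [K]. *)
pose F (x : 'rV[R]_n) := [set y : 'rV[R]_n | T (x + t0 - y)%R].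
pose G (x : 'rV[R]_n) := [set y : 'rV[R]_n | T° (x + t0 - y)%R].
have mF x : measurable (F x : set (Rn R n)).
  by apply: closed_Rn_measurable; exact: closed_sub_preimage.
have [s _ Ks] : finite_subset_cover K G K.
  move: cK; rewrite compact_cover => /(_ _ K G); apply => x Kx.
    have -> : G x = (fun y : 'rV[R]_n => x + t0 - y)%R @^-1` T° by [].
    apply: open_comp; last exact: open_interior.
    by move=> y _; exact: rV_subl_continuous.
  by exists x; rewrite // /G /= addrAC subrr add0r.
have mUF (r : seq 'rV[R]_n) :
    measurable (\big[setU/set0]_(x <- r) F x : set (Rn R n)).
  by apply: bigsetU_measurable => x _; exact: mF.
apply: (@le_lt_trans _ _ (mu (\big[setU/set0]_(x <- s) F x))).
  apply: le_Rn_measure => //; first exact: compact_Rn_measurable.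
  by move=> y /Ks[x xs Gy]; rewrite -bigcup_seq; exists x => //;
    exact: (@interior_subset _ T _ Gy).
elim: (s : seq _) => [|x r ih]; first by rewrite big_nil measure0.
rewrite big_cons; apply: le_lt_trans (measureU2 _ (mF x) (mUF r)) _.
by rewrite lte_add_pinfty// (le_lt_trans (muT _)) ?ltry.
Qed.

(** The pairs [(x, y)] with [y - x] in [T] are counted twice: the section at [x] is [x + T], charged
    by [nu], and the section at [y] is [y - T], bounded by [mu]. *)
Lemma packing_le_covering mu nu K T : compact K -> closed T -> T° !=set0 ->
  (forall x, mu [set y | T (x - y)%R] <= 1) ->
  (forall x, K x -> 1 <= nu [set y | T (y - x)%R]) ->
  mu K <= nu setT.
Proof.
move=> cK cT T0 muT nuT.
have [->|] := eqVneq (nu setT) +oo; first exact: leey.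
rewrite -ltey => nuoo.
apply: (section_double_counting (compact_Rn_measurable cK)
  (packing_compact_lty cK cT T0 muT) nuoo (measurable_difference cT)).
- move=> y; rewrite (_ : ysection _ y = [set x | T (y - x)%R]); first exact: muT.
  by apply/seteqP; split => x; [exact: set_mem|exact: mem_set].
- move=> x Kx; rewrite (_ : xsection _ x = [set y | T (y - x)%R]); first exact: nuT.
  by apply/seteqP; split => y; [exact: set_mem|exact: mem_set].
Qed.

Lemma Mstar_le_Nstar_reflect K T : compact K -> closed T -> T° !=set0 ->
  Mstar K T <= Nstar K [set (- t)%R | t in T].
Proof.
move=> cK cT T0; apply: ge_ereal_sup => _ [mu [_ muT] <-].
apply: le_ereal_inf_tmp => _ [nu [_ nuT] <-].
apply: (packing_le_covering cK cT T0) => x.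
  by rewrite -conv_indicE.
move=> Kx; have := nuT x; rewrite conv_indicE; last exact: closed_reflect.
by rewrite reflect_translateE indicE mem_set.
Qed.

End weak_duality.

Theorem theorem1p3 (R : realType) (n : nat) (K T : set 'rV[R]_n) :
  compact K -> compact T -> T° !=set0 ->
  Momega K T = Mstar K T /\ Mstar K T = Nstar K [set - t | t in T].
Proof.
move=> cK cT T0.
have clT : closed T by apply: compact_closed => //; exact: norm_hausdorff.
have le1 := le_Momega_Mstar K clT.
have le2 := Mstar_le_Nstar_reflect cK clT T0.
have le3 := Nstar_reflect_le_Momega K cT.
split; apply/eqP; rewrite eq_le; apply/andP; split => //.
  exact: le_trans le2 le3.
exact: le_trans le3 le1.
Qed.
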